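(* Let $\mathsf{C}_{\bullet,M}=(H_\bullet,d_{\bullet,M})$ and $\mathsf{C}_{\bullet,m}=(H_\bullet,d_{\bullet,m})$ be two Fredholm Hilbert complexes on the same Hilbert spaces $H_0,\dots,H_n$ such that, for each $q$, $d_{q,M}$ is a closed extension of $d_{q,m}$. Let $H^q(\mathsf{C}''_\bullet)$ be the cohomology of the complex of relative harmonic vectors of the pair $(\mathsf{C}_{\bullet,M},\mathsf{C}_{\bullet,m})$. Then for each $q$ there is an isomorphism of vector spaces $$H^{q}(\mathsf{C}''_{\bullet})\oplus \mathcal{H}^{q-1}_{m}(\mathsf{C}_{\bullet,M},\mathsf{C}_{\bullet,m})\cong H^{q}(\mathsf{C}_{\bullet,m})\oplus H^{q-1}(\mathsf{C}_{\bullet,M}).$$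
   Context: A Hilbert complex $(H_\bullet,d_\bullet)$ consists of Hilbert spaces $H_0,\dots,H_n$ and densely defined closed linear operators $d_q:D(d_q)\subset H_q\to H_{q+1}$, $0\le q\le n-1$, with $d_q(D(d_q))\subseteq D(d_{q+1})$ and $d_{q+1}\circ d_q=0$; by convention $H_{-1}=H_{n+1}=0$, $d_{-1}=0$, and $d_n=0$ with $D(d_n)=H_n$. Its cohomology is $H^q=\ker(d_q)/\operatorname{Im}(d_{q-1})$. The complex is Fredholm if every $H^q$ is finite dimensional. For a pair $\mathsf{C}_{\bullet,M},\mathsf{C}_{\bullet,m}$ of Hilbert complexes on the same Hilbert spaces with $D(d_{q,m})\subset D(d_{q,M})$ and $d_{q,M}|_{D(d_{q,m})}=d_{q,m}$ for all $q$, set $\delta_{q,m}:=(d_{q-1,M})^*$ and $\delta_{q,M}:=(d_{q-1,m})^*$ (Hilbert space adjoints, operators from $H_q$ to $H_{q-1}$); $\delta_{q,M}$ is a closed extension of $\delta_{q,m}$. Define $P_q:=d_{q-1,M}\circ\delta_{q,M}+\delta_{q+1,M}\circ d_{q,M}$ on $D(P_q)=\{s\in D(d_{q,M})\cap D(\delta_{q,M}) : d_{q,M}s\in D(\delta_{q+1,M}),\ \delta_{q,M}s\in D(d_{q-1,M})\}$. The operator $d_{q,m}$ maps $\ker(P_q)\cap D(d_{q,m})$ into $\ker(P_{q+1})\cap D(d_{q+1,m})$; let $d''_q$ be its restriction to $\ker(P_q)\cap D(d_{q,m})$. The complex $\mathsf{C}''_\bullet=(\ker(P_\bullet)\cap D(d_{\bullet,m}),d''_\bullet)$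 is the complex of relative harmonic vectors of the pair, and $H^q(\mathsf{C}''_\bullet)=\ker(d''_q)/\operatorname{Im}(d''_{q-1})$. $\mathcal{H}^{q}_{m}(\mathsf{C}_{\bullet,M},\mathsf{C}_{\bullet,m}):=\ker(d_{q,m})\cap\ker(\delta_{q,m})$. *)

(* Defs.v *)
(* Hilbert spaces are complex: the scalars are R[i] for R : realType. *)
From HB Require Import structures.
From mathcomp Require Import all_boot all_order all_algebra.
From mathcomp Require Import generic_quotient ring_quotient complex sesquilinear.
From mathcomp Require Import boolp classical_sets reals topology normedtype.

Set Implicit Arguments.
Unset Strict Implicit.
Unset Printing Implicit Defensive.

Import Order.TTheory GRing.Theory Num.Theory.
Import numFieldNormedType.Exports.

Local Open Scope classical_set_scope.
Local Open Scope ring_scope.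
Local Open Scope quotient_scope.

Structure subspace (K : nzRingType) (V : lmodType K) := Subspace {
  subspace_set :> V -> Prop;
  subspace0 : subspace_set 0;
  subspaceP : forall (a : K) (x y : V),
    subspace_set x -> subspace_set y -> subspace_set (a *: x + y) }.

Section SubspaceTheory.
Context (K : nzRingType) (V : lmodType K).
Implicit Types A B : subspace V.

Program Definition subspaceI A B : subspace V :=
  @Subspace K V (fun x => A x /\ B x) _ _.
Next Obligation. by move=> A B; split; exact: subspace0. Qed.
Next Obligation.
by move=> A B a x y [Ax Bx] [Ay By]; split; exact: subspaceP.
Qed.

Definition subspace_pred A : {pred V} := fun x => `[< A x >].

Lemma subspace_pred_closed A : submod_closed (subspace_pred A).
Proof.
split=> [|a x y]; first by apply/asboolP; exact: subspace0.
by move=> /asboolP Ax /asboolP Ay; apply/asboolP; exact: subspaceP.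
Qed.

HB.instance Definition _ A :=
  GRing.isSubmodClosed.Build K V (subspace_pred A) (subspace_pred_closed A).

End SubspaceTheory.

Section SubspaceType.
Context (K : nzRingType) (V : lmodType K) (A : subspace V).

Record subspace_type :=
  SubspaceType { subspace_val : V; _ : subspace_val \in subspace_pred A }.

HB.instance Definition _ := [isSub for subspace_val].
HB.instance Definition _ := [Choice of subspace_type by <:].
HB.instance Definition _ := [SubChoice_isSubLmodule of subspace_type by <:].

End SubspaceType.

Section QuotientSpace.
Context (K : nzRingType) (W : lmodType K) (B : subspace W).

Definition quot_space := Quotient.quot (subspace_pred B).

HB.instance Definition _ := GRing.Zmodule.on quot_space.
HB.instance Definition _ : EqQuotient W _ quot_space := EqQuotient.on quot_space.

Definition quot_scale (a : K) : quot_space -> quot_space :=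
  lift_op1 quot_space ( *:%R a).

Lemma pi_quot_scale a : {morph \pi_quot_space : x / a *: x >-> quot_scale a x}.
Proof.
move=> x; unlock quot_scale; apply/eqP; rewrite piE /Quotient.equiv.
by rewrite -scalerBr rpredZ// Quotient.idealrBE reprK.
Qed.

Lemma quot_addE (x y : W) :
  \pi_quot_space (x + y) = (\pi_quot_space x + \pi_quot_space y)%R.
Proof. exact: Quotient.pi_add. Qed.

Lemma quot_scalerA a b v :
  quot_scale a (quot_scale b v) = quot_scale (a * b) v.
Proof. by rewrite -[v]reprK -!pi_quot_scale scalerA. Qed.

Lemma quot_scale1r : left_id 1 quot_scale.
Proof. by move=> v; rewrite -[v]reprK -!pi_quot_scale scale1r. Qed.

Lemma quot_scalerDr : right_distributive quot_scale +%R.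
Proof.
move=> a u v; rewrite -[u]reprK -[v]reprK.
by rewrite -quot_addE -!pi_quot_scale scalerDr quot_addE.
Qed.

Lemma quot_scalerDl v : {morph quot_scale^~ v : a b / a + b}.
Proof.
by move=> a b; rewrite -[v]reprK -!pi_quot_scale scalerDl quot_addE.
Qed.

HB.instance Definition _ := GRing.Zmodule_isLmodule.Build K quot_space
  quot_scalerA quot_scale1r quot_scalerDr quot_scalerDl.

End QuotientSpace.

Section Subquotient.
Context (K : nzRingType) (V : lmodType K) (A B : subspace V).

Program Definition subspace_trace : subspace (subspace_type A) :=
  @Subspace K (subspace_type A) (fun x => B (val x)) _ _.
Next Obligation. exact: subspace0. Qed.
Next Obligation. by move=> a x y Bx By; exact: subspaceP. Qed.

(* A / (A `&` B), which is A / B when B is contained in A, the only case used *)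
Definition subquot : lmodType K := quot_space subspace_trace.

End Subquotient.

Definition finite_dim (K : nzRingType) (V : lmodType K) : Prop :=
  exists (k : nat) (e : 'I_k -> V),
    forall v, exists c : 'I_k -> K, v = \sum_i c i *: e i.

Definition lmod_iso (K : nzRingType) (V W : lmodType K) : Prop :=
  exists f : {linear V -> W}, bijective f.

(* [ip] is linear in its first argument and conjugate-linear in its second *)
Structure hilbert (R : realType) := Hilbert {
  hilbert_sort :> completeNormedModType R[i];
  ip : {dot hilbert_sort for @Num.conj R[i]};
  ip_norm : forall x, ip x x = `|x| ^+ 2 }.

(* The values of [opfun] outside [dom] are irrelevant. *)
Structure linop (K : nzRingType) (U V : lmodType K) := Linop {
  dom : subspace U;
  opfun :> U -> V;
  op_linear : forall (a : K) (x y : U), dom x -> dom y ->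
    opfun (a *: x + y) = a *: opfun x + opfun y }.

Section LinopTheory.
Context (K : nzRingType).
Implicit Types U V W : lmodType K.

Lemma opD U V (T : linop U V) x y :
  dom T x -> dom T y -> T (x + y) = T x + T y.
Proof. by move=> Tx Ty; have := op_linear 1 Tx Ty; rewrite !scale1r. Qed.

Lemma op0 U V (T : linop U V) : T 0 = 0.
Proof.
have := opD (subspace0 (dom T)) (subspace0 (dom T)).
by rewrite addr0 => /(congr1 (fun z => z - T 0)); rewrite addrK subrr.
Qed.

Program Definition ker U V (T : linop U V) : subspace U :=
  @Subspace K U (fun x => dom T x /\ T x = 0) _ _.
Next Obligation. by move=> U V T; split; [exact: subspace0|exact: op0]. Qed.
Next Obligation.
move=> U V T a x y [Tx x0] [Ty y0]; split; first exact: subspaceP.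
by rewrite op_linear// x0 y0 scaler0 addr0.
Qed.

Program Definition im U V (T : linop U V) : subspace V :=
  @Subspace K V (fun y => exists2 x, dom T x & T x = y) _ _.
Next Obligation.
by move=> U V T; exists 0; [exact: subspace0|exact: op0].
Qed.
Next Obligation.
move=> U V T a _ _ [x Tx <-] [y Ty <-].
by exists (a *: x + y); [exact: subspaceP|exact: op_linear].
Qed.

Program Definition op_restr U V (T : linop U V) (A : subspace U) : linop U V :=
  @Linop K U V (subspaceI A (dom T)) T _.
Next Obligation. by move=> U V T A a x y [_ Tx] [_ Ty]; exact: op_linear. Qed.

Program Definition op_comp_dom U V W (S : linop V W) (T : linop U V) :
    subspace U :=
  @Subspace K U (fun x => dom T x /\ dom S (T x)) _ _.
Next Obligation.
by move=> U V W S T; split; rewrite ?op0; exact: subspace0.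
Qed.
Next Obligation.
move=> U V W S T a x y [Tx STx] [Ty STy]; split; first exact: subspaceP.
by rewrite op_linear//; exact: subspaceP.
Qed.

Program Definition op_comp U V W (S : linop V W) (T : linop U V) : linop U W :=
  @Linop K U W (op_comp_dom S T) (fun x => S (T x)) _.
Next Obligation.
by move=> U V W S T a x y [Tx STx] [Ty STy]; rewrite !op_linear.
Qed.

Program Definition op_add U V (S T : linop U V) : linop U V :=
  @Linop K U V (subspaceI (dom S) (dom T)) (fun x => S x + T x) _.
Next Obligation.
move=> U V S T a x y [Sx Tx] [Sy Ty].
by rewrite !op_linear// scalerDr addrACA.
Qed.

Definition op_extends U V (T S : linop U V) : Prop :=
  forall x, dom S x -> dom T x /\ T x = S x.

End LinopTheory.

Section HilbertOperators.
Context (R : realType).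
Implicit Types U V : hilbert R.

Definition closed_op U V (T : linop U V) : Prop :=
  closed [set p : U * V | dom T p.1 /\ p.2 = T p.1].

Structure ddop U V := Ddop {
  ddop_op :> linop U V;
  ddop_dense : dense [set x : U | dom ddop_op x] }.

Section Adjoint.
Context (U V : hilbert R) (T : ddop U V).

Definition adj_rel (y : V) (z : U) : Prop :=
  forall x, dom T x -> ip V (T x) y = ip U x z.

Lemma adj_rel_uniq y z1 z2 : adj_rel y z1 -> adj_rel y z2 -> z1 = z2.
Proof.
move=> h1 h2; apply/eqP; rewrite -subr_eq0; apply/negP => /negP w0.
set w := z1 - z2 in w0.
have Tw x : dom T x -> ip U x w = 0.
  by move=> Tx; rewrite linearBr /= -h1// -h2// subrr.
have [|x [/= xw Tx]] := ddop_dense T _ (ball_open w `|w|).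
  by exists w; apply: ballxx; rewrite normr_gt0.
move: xw; rewrite -ball_normE /ball_ /= => xw.
have : `|w - x| ^+ 2 < `|w| ^+ 2 by rewrite ltrXn2r.
have wx : ip U w x = 0.
  rewrite hermC -[RHS](mulr0 ((-1) ^+ false)) -[in RHS](rmorph0 Num.conj).
  by congr (_ * Num.conj _); exact: Tw.
have xw0 : ip U x w = 0 := Tw x Tx.
have -> : `|w - x| ^+ 2 = `|w| ^+ 2 + `|x| ^+ 2.
  rewrite -!ip_norm.
  have -> : ip U (w - x) (w - x) = ip U w w - ip U w x - (ip U x w - ip U x x).
    by rewrite linearBl !linearBr.
  by rewrite wx xw0 subr0 sub0r opprK.
by rewrite gtrDl le_gtF ?exprn_ge0.
Qed.

Lemma adj_rel0 : adj_rel 0 0.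
Proof. by move=> x _; rewrite !linear0r. Qed.

Lemma adj_rel_linear a y1 y2 z1 z2 :
  adj_rel y1 z1 -> adj_rel y2 z2 -> adj_rel (a *: y1 + y2) (a *: z1 + z2).
Proof.
move=> h1 h2 x Tx.
transitivity (Num.conj a * ip V (T x) y1 + ip V (T x) y2).
  exact: linearPr.
by rewrite h1// h2//; apply/esym; exact: linearPr.
Qed.

Program Definition adj_dom : subspace V :=
  @Subspace R[i] V (fun y => exists z, adj_rel y z) _ _.
Next Obligation. by exists 0; exact: adj_rel0. Qed.
Next Obligation.
move=> a y1 y2 [z1 h1] [z2 h2].
by exists (a *: z1 + z2); exact: adj_rel_linear.
Qed.

Definition adj_fun (y : V) : U := xget 0 [set z | adj_rel y z].

Lemma adj_funP y z : adj_rel y z -> adj_fun y = z.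
Proof.
by move=> h; apply: (@adj_rel_uniq y) => //; exact: (@xgetI _ _ _ z).
Qed.

Program Definition adj : linop V U := @Linop R[i] V U adj_dom adj_fun _.
Next Obligation.
move=> a y1 y2 [z1 h1] [z2 h2].
by rewrite (adj_funP h1) (adj_funP h2); apply: adj_funP; exact: adj_rel_linear.
Qed.

End Adjoint.
End HilbertOperators.

(* The degree q ranges over int, so that the conventions about degrees -1 and
   n+1 are instances of [hc_bounded].  There is nothing to require of d_n beyond
   [hc_closed]: its target is zero and its graph is closed, so its dense domain
   is all of H n.  The differential d_q is [hc_op q r] with q + 1 = r; the two
   indices let d_(q-1) land in H q itself rather than in H (q - 1 + 1), and the
   other pairs of indices carry no information. *)
Structure hilbert_complex (R : realType) (n : nat) (H : int -> hilbert R) :=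
  HilbertComplex {
    hc_op :> forall q r : int, ddop (H q) (H r);
    hc_bounded : forall q : int, ~~ (0 <= q <= n%:Z) ->
      forall x : H q, x = 0;
    hc_closed : forall q r : int, q + 1 = r -> closed_op (hc_op q r);
    hc_dom : forall q r s : int, q + 1 = r -> r + 1 = s ->
      forall x, dom (hc_op q r) x -> dom (hc_op r s) (hc_op q r x);
    hc_dd : forall q r s : int, q + 1 = r -> r + 1 = s ->
      forall x, dom (hc_op q r) x -> hc_op r s (hc_op q r x) = 0 }.

Section Complexes.
Context (R : realType) (n : nat) (H : int -> hilbert R).
Implicit Types C CM Cm : hilbert_complex n H.

Definition cohomology C (q : int) : lmodType R[i] :=
  subquot (ker (C q (q + 1))) (im (C (q - 1) q)).

Definition fredholm C : Prop := forall q, finite_dim (cohomology C q).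

Definition complex_extends CM Cm : Prop :=
  forall q r : int, q + 1 = r -> op_extends (CM q r) (Cm q r).

(* [delta_m CM r q] and [delta_M Cm r q], with q + 1 = r, are delta_(r, m) and
   delta_(r, M), operators from H r to H q. *)
Definition delta_m CM (r q : int) : linop (H r) (H q) := adj (CM q r).
Definition delta_M Cm (r q : int) : linop (H r) (H q) := adj (Cm q r).

Definition laplacian CM Cm (q : int) : linop (H q) (H q) :=
  op_add (op_comp (CM (q - 1) q) (delta_M Cm q (q - 1)))
         (op_comp (delta_M Cm (q + 1) q) (CM q (q + 1))).

Definition relharm_d CM Cm (q r : int) : linop (H q) (H r) :=
  op_restr (Cm q r) (ker (laplacian CM Cm q)).

Definition relharm_cohomology CM Cm (q : int) : lmodType R[i] :=
  subquot (ker (relharm_d CM Cm q (q + 1))) (im (relharm_d CM Cm (q - 1) q)).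

Definition harm_m CM Cm (q : int) : lmodType R[i] :=
  subspace_type (subspaceI (ker (Cm q (q + 1))) (ker (delta_m CM q (q - 1)))).

End Complexes.

(* Main.v *)
(* Harmonic decompositions give the isomorphism explicitly: it sends
   (s, h) to ([s], [delta_(q, M) s + h]), where s in ker d_(q, m) satisfies
   d_(q-1, M) (delta_(q, M) s) = 0 and h is a vector of harm_m.  It is onto
   because ker d_(q-1, M) is the sum of Im d_(q-2, M), of
   A = ker d_(q-1, M) /\ (ker d_(q-1, m))^perp and of harm_m, while
   (ker d_(q-1, m))^perp is the image of Im d_(q-1, m) under delta_(q, M).

   The analytic input is that the relevant ranges, including A + Im d_(q-2, M),
   are closed.  All of them are ranges of closed linear relations having finite
   codimension in a closed subspace, and for these the open mapping theorem
   applies after a complement has been added to the range. *)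
From HB Require Import structures.
From mathcomp Require Import all_boot all_order all_algebra.
From mathcomp Require Import complex reals.
From mathcomp Require Import generic_quotient ring_quotient sesquilinear.
From mathcomp Require Import boolp classical_sets topology normedtype.
From mathcomp Require Import prodnormedzmodule ring lra.
(* Imported last because topology has a [subspace] of its own. *)
Require Import Defs.

Set Implicit Arguments.
Unset Strict Implicit.
Unset Printing Implicit Defensive.

Import Order.TTheory GRing.Theory Num.Theory.
Import numFieldNormedType.Exports.

Local Open Scope classical_set_scope.
Local Open Scope ring_scope.
Local Open Scope complex_scope.

(** * Linear bijections and subquotients *)

(** Maps between cohomologies are described on representatives, hence as relations. Linearity of [r]
    reduces well-definedness and injectivity to the two clauses at 0. *)
Lemma lmod_iso_rel (K : nzRingType) (V W : lmodType K) (r : V -> W -> Prop) :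
  (forall a v v' w w', r v w -> r v' w' -> r (a *: v + v') (a *: w + w')) ->
  (forall v, exists w, r v w) -> (forall w, exists v, r v w) ->
  (forall w, r 0 w -> w = 0) -> (forall v, r v 0 -> v = 0) ->
  lmod_iso V W.
Proof.
move=> rP tot sur fun0 inj0.
have rB v v' w w' : r v w -> r v' w' -> r (v - v') (w - w').
  move=> h h'; rewrite (addrC v) (addrC w) -(scaleN1r v') -(scaleN1r w'); exact: rP.
have [f fP] := choice tot; have [g gP] := choice sur.
have funE v w : r v w -> f v = w.
  move=> vw; apply/eqP; rewrite -subr_eq0; apply/eqP/fun0.
  by rewrite -(subrr v); apply: rB.
have injE v w : r v w -> g w = v.
  move=> vw; apply/eqP; rewrite -subr_eq0; apply/eqP/inj0.
  by rewrite -(subrr w); exact: rB.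
have f_lin : linear f by move=> a u v; apply: funE; exact: rP.
pose L := GRing.isLinear.Build K V W _ f f_lin.
pose F : {linear V -> W} := HB.pack f L.
by exists F; exists g => [v|w] /=; [exact: injE|exact: funE].
Qed.

Section SubspaceClosure.
Context (K : nzRingType) (V : lmodType K) (A : subspace V).

Lemma subspaceD x y : A x -> A y -> A (x + y).
Proof. by move=> Ax Ay; rewrite -[x]scale1r; exact: subspaceP. Qed.

Lemma subspaceZ a x : A x -> A (a *: x).
Proof.
by move=> Ax; rewrite -[_ *: _]addr0; apply: subspaceP => //; exact: subspace0.
Qed.

Lemma subspaceB x y : A x -> A y -> A (x - y).
Proof.
by move=> Ax Ay; rewrite -scaleN1r; apply: subspaceD => //; exact: subspaceZ.
Qed.

Lemma subspace_sum k (c : 'I_k -> K) (e : 'I_k -> V) :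
  (forall i, A (e i)) -> A (\sum_i c i *: e i).
Proof.
move=> Ae; apply: (big_ind A) => [||i _]; first exact: subspace0.
  exact: subspaceD.
exact: subspaceZ.
Qed.

End SubspaceClosure.

Section SubquotClass.
Context (K : nzRingType) (V : lmodType K) (A B : subspace V).
Local Open Scope quotient_scope.

(** Relates a class to all its representatives, so that later arguments may choose a convenient
    vector of [V]. *)
Definition subquot_class (x : subquot A B) (v : V) : Prop :=
  exists2 w : subspace_type A, val w = v & \pi_(subquot A B) w = x.

Lemma subquot_class_linear a x y v w : subquot_class x v -> subquot_class y w ->
  subquot_class (a *: x + y) (a *: v + w).
Proof.
move=> [v' <- <-] [w' <- <-]; exists (a *: v' + w'); first by [].
by rewrite quot_addE pi_quot_scale.
Qed.

Lemma subquot_class_ex x : exists v, subquot_class x v.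
Proof. by exists (val (repr x)); exists (repr x); rewrite ?reprK. Qed.

Lemma subquot_class_sub x v : subquot_class x v -> A v.
Proof. by move=> [[w wA] /= <- _]; apply/asboolP. Qed.

Lemma subquot_class_sur v : A v -> exists x, subquot_class x v.
Proof.
move=> Av; have vA : v \in subspace_pred A by apply/asboolP.
by exists (\pi_(subquot A B) (SubspaceType vA : subspace_type A)); exists (SubspaceType vA).
Qed.

Lemma subquot_class_eqP x y v w :
  subquot_class x v -> subquot_class y w -> (x = y <-> B (v - w)).
Proof.
move=> [v' <- <-] [w' <- <-].
have E : \pi_(subquot A B) v' == \pi_(subquot A B) w' = `[< B (val v' - val w') >].
  by rewrite -[LHS]Quotient.idealrBE.
by split=> [/eqP|Bvw]; [rewrite E => /asboolP|apply/eqP; rewrite E; apply/asboolP].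
Qed.

Lemma subquot_class0 : subquot_class 0 0.
Proof.
exists 0 => //; apply: (addrI (\pi_(subquot A B) 0)).
by rewrite addr0 -quot_addE addr0.
Qed.

Lemma subquot_class0P x v : subquot_class x v -> (x = 0 <-> B v).
Proof. by move=> /subquot_class_eqP/(_ subquot_class0); rewrite subr0. Qed.

Lemma subquot_class_shift x v w :
  subquot_class x v -> A w -> B (v - w) -> subquot_class x w.
Proof.
move=> xv /subquot_class_sur[y yw] Bvw.
by have -> : x = y by apply/(subquot_class_eqP xv yw).
Qed.

End SubquotClass.

(** * Real-valued norm *)

(** The norm takes values in [R[i]], whose order is partial; estimates are carried out in the
    ordered field [R]. *)
Definition nrm (R : realType) (V : normedModType R[i]) (x : V) : R := complex.Re `|x|.

Section RealNorm.
Context (R : realType).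
Implicit Types (V : normedModType R[i]).

Lemma nrmE V (x : V) : `|x| = (nrm x)%:C.
Proof. by rewrite /nrm RRe_real// normr_real. Qed.

Lemma nrm_ge0 V (x : V) : 0 <= nrm x.
Proof. by rewrite -lecR -nrmE normr_ge0. Qed.

Lemma nrm0 V : nrm (0 : V) = 0.
Proof. by rewrite /nrm normr0. Qed.

Lemma nrm0_eq0 V (x : V) : nrm x = 0 -> x = 0.
Proof. by move=> x0; apply/eqP; rewrite -normr_eq0 nrmE x0. Qed.

Lemma nrmN V (x : V) : nrm (- x) = nrm x.
Proof. by rewrite /nrm normrN. Qed.

Lemma nrmBC V (x y : V) : nrm (x - y) = nrm (y - x).
Proof. by rewrite /nrm distrC. Qed.

Lemma nrmD V (x y : V) : nrm (x + y) <= nrm x + nrm y.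
Proof. by rewrite -lecR rmorphD/= -!nrmE ler_normD. Qed.

Lemma nrm_dist V (y x z : V) : nrm (x - z) <= nrm (x - y) + nrm (y - z).
Proof. by apply: le_trans (nrmD _ _); rewrite addrA subrK. Qed.

Lemma nrmZ V (a : R[i]) (x : V) : nrm (a *: x) = complex.Re `|a| * nrm x.
Proof.
apply: complexI; rewrite rmorphM -!nrmE normrZ; congr (_ * _).
exact: nrmE.
Qed.

Lemma nrmZr V (a : R) (x : V) : nrm (a%:C *: x) = `|a| * nrm x.
Proof. by rewrite nrmZ normc_def/= expr0n/= addr0 sqrtr_sqr. Qed.

Lemma ball_nrm V (x y : V) (e : R) : ball x e%:C y <-> nrm (x - y) < e.
Proof. by rewrite -ball_normE /ball_/= nrmE ltcR. Qed.

Lemma nrm_fst V1 V2 (p : V1 * V2) : nrm p.1 <= nrm p.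
Proof.
by rewrite -lecR -!nrmE prod_normE comparable_le_max ?lexx ?real_comparable ?normr_real.
Qed.

Lemma nrm_snd V1 V2 (p : V1 * V2) : nrm p.2 <= nrm p.
Proof.
by rewrite -lecR -!nrmE prod_normE comparable_le_max ?lexx ?orbT ?real_comparable ?normr_real.
Qed.

Lemma nrm_pair_le V1 V2 (p : V1 * V2) e : nrm p.1 <= e -> nrm p.2 <= e -> nrm p <= e.
Proof.
rewrite -!lecR -!nrmE => h1 h2; rewrite prod_normE comparable_ge_max ?h1 ?h2//.
by rewrite real_comparable ?normr_real.
Qed.

End RealNorm.

(** * Geometric decay and completeness *)

Lemma half_pow_lt (R : realType) (C e : R) : 0 < e -> exists n, C / 2 ^+ n < e.
Proof.
move=> e0; pose n := Num.bound `|C / e|; exists n.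
rewrite ltr_pdivrMr ?exprn_gt0// mulrC -ltr_pdivrMr//.
apply: le_lt_trans (ler_norm _) _.
apply: lt_le_trans (archi_boundP (normr_ge0 _)) _.
by rewrite -natrX ler_nat ltnW// ltn_expl.
Qed.

Section Complete.
Context (R : realType).

(* Completeness in a form which passes to products at once. *)
Definition geom_complete (V : normedModType R[i]) := forall (u : nat -> V) (C : R),
  (forall n, nrm (u n.+1 - u n) <= C / 2 ^+ n) ->
  exists l, forall n, nrm (l - u n) <= 2 * C / 2 ^+ n.

Lemma geom_dist (V : normedModType R[i]) (u : nat -> V) (C : R) :
  (forall n, nrm (u n.+1 - u n) <= C / 2 ^+ n) ->
  forall n m, (n <= m)%N -> nrm (u m - u n) <= 2 * C / 2 ^+ n.
Proof.
move=> h n m nm.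
have C0 : 0 <= C by have := h 0; rewrite expr0 divr1; apply: le_trans; exact: nrm_ge0.
(* The subtracted term [2 ^- (n + k)], the tail of the geometric series, lets the induction on [k]
   close. *)
suff H k : nrm (u (n + k)%N - u n) <= 2 * C * (2 ^- n - 2 ^- (n + k)).
  rewrite -(subnKC nm); apply: le_trans (H _) _.
  by rewrite ler_wpM2l ?mulr_ge0// gerBl invr_ge0 exprn_ge0.
elim: k => [|k IH]; first by rewrite addn0 !subrr nrm0 mulr0.
rewrite addnS; apply: le_trans (nrm_dist (u (n + k)%N) _ _) _.
apply: le_trans (lerD (h _) IH) _.
by rewrite exprS invfM; lra.
Qed.

Lemma complete_geom (V : completeNormedModType R[i]) : geom_complete V.
Proof.
move=> u C h; have d := geom_dist h.
have C0 : 0 <= C by have := h 0; rewrite expr0 divr1; apply: le_trans; exact: nrm_ge0.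
have : cvg (u @ \oo).
  apply: cauchy_cvg; apply: cauchy_exP => e e0.
  have eE : e = (complex.Re e)%:C by rewrite RRe_real// gtr0_real.
  move: e0; rewrite eE ltcR => e0.
  have [n ne] := half_pow_lt (2 * C) e0.
  exists (u n); exists n => // m /= nm; apply/ball_nrm.
  by rewrite nrmBC; apply: le_lt_trans (d _ _ nm) ne.
move=> /cvg_ex[l ul]; exists l => n; apply/ler_addgt0Pr => e e0.
have : nbhs l (ball l e%:C) by apply: nbhsx_ballx; rewrite ltcR.
move=> /ul[m _ mP].
have : nrm (l - u (maxn n m)) < e by apply/ball_nrm/mP => /=; exact: leq_maxr.
have := d _ _ (leq_maxl n m); have := nrm_dist (u (maxn n m)) l (u n); lra.
Qed.

Lemma prod_geom (U V : normedModType R[i]) :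
  geom_complete U -> geom_complete V -> geom_complete (U * V)%type.
Proof.
move=> cU cV u C h.
have [|l1 h1] := cU (fst \o u) C.
  by move=> n; apply: le_trans (h n); exact: (nrm_fst (u n.+1 - u n)).
have [|l2 h2] := cV (snd \o u) C.
  by move=> n; apply: le_trans (h n); exact: (nrm_snd (u n.+1 - u n)).
by exists (l1, l2) => n; apply: nrm_pair_le; [exact: h1|exact: h2].
Qed.

End Complete.

(** * Open mapping theorem for closed linear relations *)

Lemma closure_nrmP (R : realType) (V : normedModType R[i]) (A : set V) (v : V) :
  closure A v <-> forall e : R, 0 < e -> exists2 a, A a & nrm (v - a) < e.
Proof.
split=> [clA e e0|h B Bv].
  have : nbhs v (ball v e%:C) by apply: nbhsx_ballx; rewrite ltcR.
  by move=> /clA[a [Aa /ball_nrm ae]]; exists a.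
have /nbhs_ballP[e /= e0 eB] := Bv.
have eE : e = (complex.Re e)%:C by rewrite RRe_real// gtr0_real.
move: e0; rewrite eE ltcR => e0.
have [a Aa ae] := h _ e0; exists a; split=> //.
by apply: eB; rewrite eE; apply/ball_nrm.
Qed.

Section OpenMapping.
Context (R : realType).

(** Baire category. Otherwise one chooses balls one after the other so that [E n] stays at least
    four radii away from the centre of ball [n.+1]. The centres converge to a point within two radii
    of each of them, hence in no [E n]. *)
Lemma baire_geom (V : normedModType R[i]) (E : nat -> set V) :
  geom_complete V -> (forall v, exists n, E n v) ->
  exists n v0 (r : R), 0 < r /\ forall v, nrm (v - v0) < r -> closure (E n) v.
Proof.
move=> cV covE; apply: contrapT => noint.
have step (np : nat * (V * R)) : exists q : V * R, 0 < np.2.2 ->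
    [/\ nrm (q.1 - np.2.1) < np.2.2, 0 < q.2, q.2 <= np.2.2 / 2 &
      forall a, E np.1 a -> 4 * q.2 <= nrm (q.1 - a)].
  case: np => n [v0 r] /=; have [r0|] := pselect (0 < r); last by exists (0, 0).
  apply: contrapT => noq; apply: noint; exists n, v0, r; split=> // v vr.
  apply/closure_nrmP => e e0; apply: contrapT => noa; apply: noq.
  (* The bound [e / 4] keeps [E n] four radii away; [r / 2] makes the radii decay geometrically. *)
  exists (v, Num.min (e / 4) (r / 2)) => _ /=; split=> //.
  - by rewrite lt_min !divr_gt0.
  - by rewrite ge_min lexx orbT.
  move=> a Ea; have : e <= nrm (v - a).
    by rewrite leNgt; apply/negP => ae; apply: noa; exists a.
  have : Num.min (e / 4) (r / 2) <= e / 4 by rewrite ge_min lexx.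
  by lra.
have [f fP] := choice step.
pose q := fix q n := if n is m.+1 then f (m, q m) else ((0 : V), (1 : R)).
have q0 n : 0 < (q n).2.
  by elim: n => [|n IH]; [exact: ltr01|have [] := fP (n, q n) IH].
have qS n := fP (n, q n) (q0 n).
have qle n k : (q (n + k)%N).2 <= (q n).2 / 2 ^+ k.
  elim: k => [|k IH]; first by rewrite addn0 expr0 divr1.
  rewrite addnS; have [_ _ h _] := qS (n + k)%N.
  by apply: le_trans h _; rewrite exprSr invfM mulrA ler_wpM2r ?invr_ge0.
have geo n k : nrm ((q (n + k.+1)%N).1 - (q (n + k)%N).1) <= (q n).2 / 2 ^+ k.
  by rewrite addnS; have [/ltW h _ _ _] := qS (n + k)%N; apply: le_trans h (qle _ _).
have [l lP] := cV (fun k => (q k).1) (q 0).2 (geo 0).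
have [n Enl] := covE l.
have [_ _ _ /(_ _ Enl)] := qS n; rewrite -/(q n.+1).
apply/negP; rewrite -ltNge; apply: (@le_lt_trans _ _ (2 * (q n.+1).2)); last first.
  by have := q0 n.+1; lra.
(* [lP] involves only the initial radius, so the distance from [l] to centre [n.+1] is estimated
   through a much later centre. *)
apply/ler_addgt0Pr => e e0; have [m me] := half_pow_lt (2 * (q 0).2) e0.
have lm := le_lt_trans (lP m) me.
have lnm : nrm (l - (q (n.+1 + m)%N).1) < e.
  apply: le_lt_trans (lP _) _; apply: le_lt_trans me.
  rewrite ler_wpM2l ?mulr_ge0 ?(ltW (q0 _))//.
  by rewrite lef_pV2 ?posrE ?exprn_gt0// ler_weXn2l ?leq_addl// ler1n.
have := geom_dist (u := fun k => (q (n.+1 + k)%N).1) (geo n.+1) (leq0n m).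
rewrite addn0 expr0 divr1 => h.
rewrite nrmBC; apply: le_trans (nrm_dist (q (n.+1 + m)%N).1 _ _) _.
by rewrite addrC lerD// ltW.
Qed.

(** Baire, applied to the sets of vectors with a preimage of norm at most [n], yields approximate
    preimages that halve the error. The successive corrections sum up, and closedness of [G] keeps
    the limit in [G]. *)
Lemma open_mapping (U V : normedModType R[i]) (G : subspace (U * V)%type) :
  geom_complete U -> geom_complete V -> closed [set p | G p] ->
  (forall v, exists u, G (u, v)) ->
  exists C : R, forall v, exists2 u, G (u, v) & nrm u <= C * nrm v.
Proof.
move=> cU cV clG surG.
have [|n [v0 [r [r0 rP]]]] := baire_geom
    (E := fun n => [set v | exists2 u, G (u, v) & nrm u <= n%:R]) cV.
  move=> v; have [u Guv] := surG v; exists (Num.bound (nrm u)); exists u => //.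
  exact/ltW/archi_boundP/nrm_ge0.
(* Two preimages differ by at most [2 * n%:R] in norm, and the difference is later divided by
   [t = r / (2 * nrm v)]. *)
pose C := 4 * n%:R / r.
have C0 : 0 <= C by rewrite !mulr_ge0// invr_ge0 ltW.
have approx v : exists p : U * V, [/\ G p, nrm p.1 <= C * nrm v &
    nrm (v - p.2) <= nrm v / 2].
  have [/nrm0_eq0 ->|/eqP vN0] := pselect (nrm v = 0).
    exists 0; split; first exact: subspace0.
      by rewrite !nrm0 mulr0.
    by rewrite subr0 !nrm0 mul0r.
  have v_gt0 : 0 < nrm v by rewrite lt_def vN0 nrm_ge0.
  pose t := r / (2 * nrm v).
  have t0 : 0 < t by rewrite divr_gt0 ?mulr_gt0.
  have tv : nrm (t%:C *: v) = r / 2.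
    by rewrite nrmZr gtr0_norm// /t; field.
  (* Two errors below [r / 8] make at most [r / 4], which is [nrm v / 2] after division by [t]. *)
  have r8 : 0 < r / 8 by rewrite divr_gt0.
  have /rP/closure_nrmP/(_ _ r8)[a [ua Ga uan] ae] : nrm (v0 + t%:C *: v - v0) < r.
    by rewrite addrAC subrr add0r tv; lra.
  (* The ball is centred at [v0]; subtracting an approximation of [v0] recentres it at 0. *)
  have /rP/closure_nrmP/(_ _ r8)[b [ub Gb ubn] be] : nrm (v0 - v0) < r.
    by rewrite subrr nrm0.
  exists ((t^-1)%:C *: ((ua, a) - (ub, b))); split; first exact/subspaceZ/subspaceB.
    rewrite /= nrmZr gtr0_norm ?invr_gt0//.
    have -> : C * nrm v = t^-1 * (2 * n%:R) by rewrite /C /t; field; rewrite ?gt_eqF.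
    rewrite ler_wpM2l ?invr_ge0 ?(ltW t0)//.
    have h : nrm (ua - ub) <= 2 * n%:R by have := nrmD ua (- ub); rewrite nrmN; lra.
    exact: h.
  have -> : v - ((t^-1)%:C *: ((ua, a) - (ub, b))).2 =
      v - (t^-1)%:C *: (a - b) by [].
  have -> : v - (t^-1)%:C *: (a - b) =
      (t^-1)%:C *: ((v0 + t%:C *: v - a) - (v0 - b)).
    have -> : v0 + t%:C *: v - a - (v0 - b) = t%:C *: v - (a - b).
      rewrite [v0 + _]addrC -!addrA; congr (_ + _).
      by rewrite !opprB addrA addrC subrKA.
    by rewrite [RHS]scalerBr scalerA -rmorphM mulVf ?gt_eqF// scale1r.
  rewrite nrmZr gtr0_norm ?invr_gt0//.
  have -> : nrm v / 2 = t^-1 * (r / 4) by rewrite /t; field; rewrite ?gt_eqF.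
  rewrite ler_wpM2l ?invr_ge0 ?(ltW t0)//.
  have := nrmD (v0 + t%:C *: v - a) (- (v0 - b)); rewrite nrmN; lra.
clearbody C; have [f fP] := choice approx.
exists (2 * C) => v.
(* Each stage adds an approximate preimage of the residual left so far. *)
pose s := fix s k := if k is m.+1 then s m + f (v - (s m).2) else (0 : U * V).
have Gs k : G (s k).
  elim: k => [|k IH] /=; first exact: subspace0.
  by apply: subspaceD => //; have [] := fP (v - (s k).2).
have s2 k : nrm (v - (s k).2) <= nrm v / 2 ^+ k.
  elim: k => [|k IH] /=; first by rewrite subr0 expr0 divr1.
  have [_ _] := fP (v - (s k).2); rewrite opprD addrA => /le_trans; apply.
  by rewrite exprSr invfM mulrA ler_wpM2r ?invr_ge0.
have s1 k : nrm ((s k.+1).1 - (s k).1) <= C * nrm v / 2 ^+ k.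
  rewrite /= addrAC subrr add0r; have [_ h _] := fP (v - (s k).2).
  by apply: le_trans h _; rewrite -mulrA ler_wpM2l.
have [l lP] := cU (fun k => (s k).1) _ s1; exists l.
  apply: (clG (l, v)); apply/closure_nrmP => e e0.
  have [k ke] := half_pow_lt (2 * (C * nrm v) + nrm v) e0.
  exists (s k); first exact: Gs.
  apply: le_lt_trans ke.
  have Cv : 0 <= 2 * (C * nrm v) / 2 ^+ k.
    by rewrite !mulr_ge0 ?nrm_ge0 ?invr_ge0 ?exprn_ge0 //.
  have v2 : 0 <= nrm v / 2 ^+ k by rewrite mulr_ge0 ?nrm_ge0 ?invr_ge0 ?exprn_ge0 //.
  apply: nrm_pair_le => /=; rewrite mulrDl.
    by have := lP k; lra.
  by have := s2 k; lra.
by have := lP 0; rewrite /= subr0 expr0 divr1 mulrA.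
Qed.

End OpenMapping.

(** * Orthogonal projection *)

Section InnerProduct.
Context (R : realType) (V : hilbert R).
Implicit Types x y z : V.

Lemma ipC x y : ip V y x = Num.conj (ip V x y).
Proof. by rewrite hermC expr0 mul1r. Qed.

Lemma ipDl x y z : ip V (x + y) z = ip V x z + ip V y z.
Proof. exact: linearDl. Qed.

Lemma ipBl x y z : ip V (x - y) z = ip V x z - ip V y z.
Proof. exact: linearBl. Qed.

Lemma ipDr x y z : ip V z (x + y) = ip V z x + ip V z y.
Proof. exact: linearDr. Qed.

Lemma ipBr x y z : ip V z (x - y) = ip V z x - ip V z y.
Proof. exact: linearBr. Qed.

Lemma ipZl a x z : ip V (a *: x) z = a * ip V x z.
Proof. exact: linearZl_LR. Qed.

Lemma ipZr a x z : ip V x (a *: z) = Num.conj a * ip V x z.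
Proof. exact: linearZr_LR. Qed.

Lemma ip0l z : ip V 0 z = 0.
Proof. exact: linear0l. Qed.

Lemma ip0r z : ip V z 0 = 0.
Proof. exact: linear0r. Qed.

Lemma ip_eq0C x y : ip V x y = 0 -> ip V y x = 0.
Proof. by move=> h; rewrite ipC h rmorph0. Qed.

Lemma ip_eq0 x : ip V x x = 0 -> x = 0.
Proof. by rewrite ip_norm => /eqP; rewrite sqrf_eq0 normr_eq0 => /eqP. Qed.

Lemma ip_nrm x : ip V x x = (nrm x ^+ 2)%:C.
Proof. by rewrite ip_norm nrmE rmorphXn. Qed.

Lemma pythagoras x y : ip V x y = 0 -> nrm (x + y) ^+ 2 = nrm x ^+ 2 + nrm y ^+ 2.
Proof.
move=> xy; apply: complexI; rewrite rmorphD -!ip_nrm ipDl.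
by rewrite !ipDr xy (ip_eq0C xy) addr0 add0r !ip_nrm.
Qed.

Lemma ip_sub_proj x y : exists c, ip V (x - c *: y) y = 0.
Proof.
have [y0|y0] := eqVneq (ip V y y) 0.
  by exists 0; rewrite (ip_eq0 y0) ip0r.
by exists (ip V x y / ip V y y); rewrite ipBl ipZl divfK ?subrr //.
Qed.

Lemma nrm_proj_le x y c : ip V (x - c *: y) y = 0 ->
  nrm x ^+ 2 = nrm (x - c *: y) ^+ 2 + nrm (c *: y) ^+ 2.
Proof.
by move=> h; rewrite -pythagoras ?subrK// ipZr h mulr0.
Qed.

(** Up to a factor [|y|], this says that the projection [c *: y] is no longer than [x], which is
    Pythagoras. *)
Lemma cauchy_schwarz x y : `|ip V x y| <= `|x| * `|y|.
Proof.
have [c cP] := ip_sub_proj x y.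
have -> : ip V x y = c * `|y| ^+ 2.
  by apply/eqP; rewrite -ip_norm -ipZl -subr_eq0 -ipBl cP.
rewrite normrM normrX normr_id expr2 mulrA -normrZ ler_wpM2r//.
rewrite !nrmE lecR -ler_sqr ?nnegrE ?nrm_ge0//.
by rewrite (nrm_proj_le cP) lerDr sqr_ge0.
Qed.

Lemma parallelogram x y :
  nrm (x + y) ^+ 2 + nrm (x - y) ^+ 2 = 2 * nrm x ^+ 2 + 2 * nrm y ^+ 2.
Proof.
have h : (nrm (x + y) ^+ 2)%:C + (nrm (x - y) ^+ 2)%:C =
    (2 : R)%:C * (nrm x ^+ 2)%:C + (2 : R)%:C * (nrm y ^+ 2)%:C.
  by rewrite rmorph_nat -!ip_nrm ipBl ipDl !ipBr !ipDr; ring.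
by apply: complexI; rewrite rmorphD [RHS]rmorphD (rmorphM _ 2) (rmorphM _ 2); exact: h.
Qed.

(** [A] is an arbitrary predicate, so that the orthogonal of a single vector is covered too. *)
Lemma closed_orthogonal (A : V -> Prop) :
  closed [set v : V | forall a, A a -> ip V v a = 0].
Proof.
move=> v /closure_nrmP h a Aa; apply/eqP; rewrite -normr_eq0 eq_le normr_ge0 andbT.
have -> : `|ip V v a| = (complex.Re `|ip V v a|)%:C by rewrite RRe_real// normr_real.
rewrite lecR; apply/ler_addgt0Pr => e e0; rewrite add0r.
(* The added 1 keeps the divisor positive when [a] is 0. *)
have na : 0 < nrm a + 1 by rewrite ltr_wpDl ?nrm_ge0.
have [w wP we] := h (e / (nrm a + 1)) (divr_gt0 e0 na).
have -> : ip V v a = ip V (v - w) a by rewrite ipBl wP// subr0.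
apply: (@le_trans _ _ (nrm (v - w) * nrm a)).
  have := cauchy_schwarz (v - w) a; rewrite !nrmE -rmorphM lecE => /andP[_].
  by [].
move: we; rewrite ltr_pdivlMr// => we.
by have := nrm_ge0 (v - w); lra.
Qed.

Program Definition orthogonal (A : subspace V) : subspace V :=
  @Subspace R[i] V (fun v => forall a, A a -> ip V v a = 0) _ _.
Next Obligation. by move=> A a Aa; exact: ip0l. Qed.
Next Obligation.
move=> A c x y hx hy a Aa; rewrite ipDl ipZl hx// hy//.
by rewrite mulr0 addr0.
Qed.

Program Definition line (e : V) : subspace V :=
  @Subspace R[i] V (fun v => exists a, v = a *: e) _ _.
Next Obligation. by move=> e; exists 0; rewrite scale0r. Qed.
Next Obligation.
move=> e c _ _ [a ->] [b ->]; exists (c * a + b).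
by rewrite scalerDl scalerA.
Qed.

(** By Pythagoras no point of the line is closer to [v] than its projection, so a [v] in the closure
    equals that projection. *)
Lemma closed_line (e : V) : closed [set v | line e v].
Proof.
move=> v /closure_nrmP h; have [c cP] := ip_sub_proj v e; exists c.
apply/eqP; rewrite -subr_eq0; apply/eqP/nrm0_eq0/eqP.
rewrite eq_le nrm_ge0 andbT; apply/ler_addgt0Pr => d d0; rewrite add0r.
have [_ [a ->] ad] := h _ d0; apply: le_trans (ltW ad).
rewrite -ler_sqr ?nnegrE ?nrm_ge0//.
have -> : v - a *: e = (v - c *: e) + (c - a) *: e.
  by rewrite scalerBl addrA subrK.
by rewrite (@pythagoras (v - c *: e)) ?lerDl ?sqr_ge0// ipZr cP mulr0.
Qed.

(** The parallelogram law makes a minimizing sequence for the distance to [A] converge; its limit is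
    the foot of the perpendicular. *)
Lemma orthogonal_projection (A : subspace V) (x : V) : closed [set v | A v] ->
  exists2 a, A a & orthogonal A (x - a).
Proof.
move=> clA.
pose S := [set r : R | exists2 a, A a & r = nrm (x - a) ^+ 2].
have infS : has_inf S.
  split; first by exists (nrm (x - 0) ^+ 2); exists 0; first exact: subspace0.
  by exists 0 => _ [a _ ->]; rewrite sqr_ge0.
have near_inf n : exists a, A a /\
    forall b, A b -> nrm (x - a) ^+ 2 <= nrm (x - b) ^+ 2 + (2 ^- n) ^+ 2.
  have e0 : 0 < (2 ^- n) ^+ 2 :> R by rewrite exprn_gt0// invr_gt0 exprn_gt0.
  have [_ [a Aa ->] lta] := inf_adherent e0 infS; exists a; split=> // b Ab.
  apply: le_trans (ltW lta) _; rewrite lerD2r.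
  by apply: ge_inf; [exact: infS.2|exists b].
have [a aP] := choice near_inf.
have a_dist n : nrm (a n.+1 - a n) <= 2 / 2 ^+ n.
  (* Comparison with the midpoint bounds the squared gap by [(2 + 2 / 4) * (2 ^- n) ^+ 2], which is
     below [(2 / 2 ^+ n) ^+ 2]. *)
  pose m : V := (2^-1 : R)%:C *: (a n.+1 + a n).
  have Am : A m.
    rewrite -[m]addr0; apply: subspaceP; last exact: subspace0.
    by rewrite -[a n.+1]scale1r; apply: subspaceP; [exact: (aP _).1|exact: (aP _).1].
  have h1 := (aP n.+1).2 _ Am; have h2 := (aP n).2 _ Am.
  have := parallelogram (x - a n) (x - a n.+1).
  have -> : x - a n + (x - a n.+1) = (2 : R)%:C *: (x - m).
    rewrite scalerBr scalerA -rmorphM divff ?pnatr_eq0// scale1r.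
    rewrite rmorph_nat scaler_nat mulr2n opprD.
    by rewrite addrACA [- a n - _]addrC.
  have -> : x - a n - (x - a n.+1) = a n.+1 - a n.
    by rewrite opprB addrC subrKA.
  rewrite nrmZr gtr0_norm// exprMn => par.
  have p0 : 0 <= 2 ^- n :> R by rewrite invr_ge0 exprn_ge0.
  have pS : 2 ^- n.+1 = 2 ^- n / 2 :> R by rewrite exprS invfM mulrC.
  rewrite pS in h1; rewrite -ler_sqr ?nnegrE ?nrm_ge0 ?mulr_ge0//.
  by move: (nrm (a n.+1 - a n)) p0 (2 ^- n) par h1 h2 => *; nra.
have [l lP] := complete_geom a_dist.
have Al : A l.
  apply: clA; apply/closure_nrmP => e e0.
  have [n ne] := half_pow_lt (2 * 2) e0.
  by exists (a n); [exact: (aP n).1|exact: le_lt_trans (lP n) ne].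
have lmin b : A b -> nrm (x - l) <= nrm (x - b).
  (* Of the 5, four come from [lP] and one from the near minimality of [a n]. *)
  move=> Ab; apply/ler_addgt0Pr => e e0; have [n ne] := half_pow_lt 5 e0.
  have p0 : 0 <= 2 ^- n :> R by rewrite invr_ge0 exprn_ge0.
  have : nrm (x - a n) <= nrm (x - b) + 2 ^- n.
    rewrite -ler_sqr ?nnegrE ?addr_ge0 ?nrm_ge0//.
    apply: le_trans ((aP n).2 _ Ab) _.
    by have := mulr_ge0 (nrm_ge0 (x - b)) p0; lra.
  have := nrm_dist (a n) x l; have := lP n; rewrite (nrmBC l); lra.
(* Moving from [l] along [b] cannot shorten the distance, so by Pythagoras the component of [x - l]
   along [b] vanishes. *)
exists l => // b Ab; have [c cP] := ip_sub_proj (x - l) b.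
have Acb : A (l + c *: b).
  by rewrite addrC; exact: subspaceP.
have := lmin _ Acb; rewrite opprD addrA => le1.
have := nrm_proj_le cP.
have : nrm (x - l) ^+ 2 <= nrm (x - l - c *: b) ^+ 2 by rewrite ler_sqr ?nnegrE ?nrm_ge0.
move=> le2 eq1.
have : nrm (c *: b) ^+ 2 = 0 by apply/eqP; rewrite eq_le sqr_ge0 andbT; lra.
move/eqP; rewrite sqrf_eq0 => /eqP/nrm0_eq0 cb0.
by move: cP; rewrite cb0 subr0.
Qed.

End InnerProduct.

(** * Closed ranges *)

Section LinearRelations.
Context (R : realType).
Implicit Types (U : normedModType R[i]) (V : hilbert R).

Program Definition rel_im (K : nzRingType) (U V : lmodType K)
    (G : subspace (U * V)%type) : subspace V :=
  @Subspace K V (fun v => exists u, G (u, v)) _ _.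
Next Obligation. by move=> K U V G; exists 0; exact: subspace0. Qed.
Next Obligation.
move=> K U V G a v w [x Gx] [y Gy]; exists (a *: x + y).
exact: (subspaceP a Gx Gy).
Qed.

(* The range of [rel_add G W] is the sum of the range of G and W, and unlike
   that range the relation is closed as soon as G and W are. *)
Program Definition rel_add (K : nzRingType) (U V : lmodType K)
    (G : subspace (U * V)%type) (W : subspace V) : subspace ((U * V) * V)%type :=
  @Subspace K ((U * V) * V)%type
    (fun p => W p.1.2 /\ G (p.1.1, p.2 - p.1.2)) _ _.
Next Obligation.
by move=> K U V G W; split=> /=; rewrite ?subr0; exact: subspace0.
Qed.
Next Obligation.
move=> K U V G W a [[u w] v] [[u' w'] v'] /= [Ww Gu] [Ww' Gu']; split.
  exact: subspaceP.
have -> : a *: v + v' - (a *: w + w') = a *: (v - w) + (v' - w').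
  by rewrite opprD addrACA scalerBr.
exact: (subspaceP a Gu Gu').
Qed.

Lemma rel_im_add (K : nzRingType) (U V : lmodType K)
    (G : subspace (U * V)%type) (W : subspace V) v :
  rel_im (rel_add G W) v <-> exists2 w, W w & rel_im G (v - w).
Proof.
split=> [[[u w] /= [Ww Gu]]|[w Ww [u Gu]]]; first by exists w => //; exists u.
by exists (u, w).
Qed.

Lemma closed_rel_add U V (G : subspace (U * V)%type) (W : subspace V) :
  closed [set p | G p] -> closed [set w | W w] ->
  closed [set p | rel_add G W p].
Proof.
move=> clG clW [[u w] v] /closure_nrmP h; split=> /=.
  apply: clW; apply/closure_nrmP => e e0.
  have [[[u' w'] v'] [Ww' _] de] := h e e0; exists w' => //.
  apply: le_lt_trans de.
  apply: le_trans (nrm_snd ((u, w) - (u', w'))) _.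
  exact: (nrm_fst (((u, w), v) - ((u', w'), v'))).
apply: clG; apply/closure_nrmP => e e0.
have e2 : 0 < e / 2 by rewrite divr_gt0.
have [[[u' w'] v'] [_ Gu'] de] := h _ e2; exists (u', v' - w') => //.
have du : nrm (u - u') < e / 2.
  apply: le_lt_trans de; apply: le_trans (nrm_fst ((u, w) - (u', w'))) _.
  exact: (nrm_fst (((u, w), v) - ((u', w'), v'))).
have dw : nrm (w - w') < e / 2.
  apply: le_lt_trans de; apply: le_trans (nrm_snd ((u, w) - (u', w'))) _.
  exact: (nrm_fst (((u, w), v) - ((u', w'), v'))).
have dv : nrm (v - v') < e / 2.
  by apply: le_lt_trans de; exact: (nrm_snd (((u, w), v) - ((u', w'), v'))).
have dvw : nrm (v - w - (v' - w')) <= nrm (v - v') + nrm (w - w').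
  have -> : v - w - (v' - w') = v - v' - (w - w').
    by rewrite !opprD !opprK addrACA.
  by have := nrmD (v - v') (- (w - w')); rewrite nrmN.
apply: (@le_lt_trans _ _ (Num.max (nrm (u - u')) (nrm (v - w - (v' - w'))))).
  by apply: nrm_pair_le; rewrite le_max lexx ?orbT.
by rewrite gt_max; apply/andP; split; lra.
Qed.

(* If e is not in the range of G, then by the open mapping theorem the coefficient
   of e in a vector of the sum depends continuously on the vector, and the range
   of G is its kernel. *)
Lemma closed_rel_im_line U V (G : subspace (U * V)%type) (e : V) :
  geom_complete U -> closed [set p | G p] ->
  closed [set v | rel_im (rel_add G (line e)) v] -> closed [set v | rel_im G v].
Proof.
move=> cU clG; set Z := rel_im (rel_add G (line e)) => clZ.
have imZ v : rel_im G v -> Z v.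
  move=> Gv; apply/rel_im_add; exists 0; first exact: subspace0.
  by rewrite subr0.
(* Adding the orthogonal complement of [Z] makes the relation onto, as the open mapping theorem
   requires. *)
pose G1 := rel_add (rel_add G (line e)) (orthogonal Z).
have [||||C CP] := @open_mapping _ _ _ G1.
- by do 2![apply: prod_geom; last exact: complete_geom].
- exact: complete_geom.
- apply: closed_rel_add; last exact: closed_orthogonal.
  by apply: closed_rel_add => //; exact: closed_line.
- move=> v; have [z Zz oz] := orthogonal_projection v clZ.
  by apply/rel_im_add; exists (v - z) => //; rewrite subKr.
move=> v clv.
have : Z v.
  apply: clZ => B /clv[w [Gw Bw]]; exists w; split=> //; exact: imZ.
move=> /rel_im_add[_ [a ->] Gv].
have [ae0|ae0] := eqVneq (a *: e) 0; first by move: Gv; rewrite ae0 subr0.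
have [Ge|Ge] := pselect (rel_im G e).
  by have := subspaceP a Ge Gv; rewrite addrC subrK.
have na : 0 < nrm (a *: e).
  rewrite lt_def nrm_ge0 andbT; apply: contra_neq ae0; exact: nrm0_eq0.
have nC : 0 < `|C| + 1 by rewrite ltr_wpDl.
(* [v'] is so close to [v] that the component of [v - v'] along [e] must be shorter than [a *: e];
   it is then shown to equal [a *: e]. *)
move/closure_nrmP: clv => /(_ _ (divr_gt0 na nC))[v' Gv' vv'].
have [[[u w] z] /= [oz [[b wb]]] Gvv'] := CP (v - v').
move=> /(le_trans (nrm_fst (u, w, z))) /(le_trans (nrm_snd (u, w))) /= wC.
have Zvv' : Z (v - v').
  apply: subspaceB; last exact: imZ.
  by apply/rel_im_add; exists (a *: e); first by exists a.
have z0 : z = 0.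
  apply/ip_eq0/oz; suff : Z (v - v' - (v - v' - z)) by rewrite subKr.
  by apply: subspaceB => //; apply/rel_im_add; exists w; [exists b|exists u].
(* Two expressions of [v - v'] differ by [(a - b) *: e], which lies in the range of [G]. *)
have ab : a = b.
  apply: contrapT => /eqP; rewrite -subr_eq0 => ab; apply: Ge.
  have : rel_im G ((v - v' - z - w) - ((v - a *: e) - v')).
    by apply: subspaceB; [exists u|exact: subspaceB].
  rewrite z0 subr0 wb.
  have -> : v - v' - b *: e - (v - a *: e - v') = (a - b) *: e.
    by rewrite [v - a *: e - v']addrAC opprB [LHS]addrC subrKA scalerBl.
  by move=> /(subspaceZ (a - b)^-1); rewrite scalerA mulVf// scale1r.
exfalso; move: vv' wC; rewrite wb -ab ltr_pdivlMr// => vv' wC.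
have := ler_wpM2r (nrm_ge0 (v - v')) (ler_norm C).
by have := nrm_ge0 (v - v'); lra.
Qed.

(** The vectors are adjoined one line at a time. The induction is general in [U] because [rel_add]
    enlarges the source. *)
Lemma closed_rel_im_finite U V (G : subspace (U * V)%type) k (e : 'I_k -> V) :
  geom_complete U -> closed [set p | G p] ->
  closed [set v | exists c : 'I_k -> R[i], rel_im G (v - \sum_i c i *: e i)] ->
  closed [set v | rel_im G v].
Proof.
elim: k U G e => [|k IH] U G e cU clG cl.
  move: cl; congr closed; apply/seteqP; split=> v /=.
    by move=> [c]; rewrite big_ord0 subr0.
  by exists (fun=> 0); rewrite big_ord0 subr0.
apply: (closed_rel_im_line (e := e ord0)) => //.
apply: (IH _ _ (e \o lift ord0)).
- by apply: prod_geom => //; exact: complete_geom.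
- by apply: closed_rel_add => //; exact: closed_line.
move: cl; congr closed; apply/seteqP; split=> v [c].
  rewrite big_ord_recl => Gv; exists (c \o lift ord0); apply/rel_im_add.
  exists (c ord0 *: e ord0); first by exists (c ord0).
  by move: Gv; rewrite opprD addrA addrAC.
move=> /rel_im_add[_ [a ->] Gv].
exists (fun i => if unlift ord0 i is Some j then c j else a).
rewrite big_ord_recl unlift_none opprD addrA addrAC.
by under eq_bigr do rewrite liftK.
Qed.

(** The hypotheses make [Z] the sum of the range of [G] and the span of [e]. *)
Lemma closed_rel_im_fincodim U V (G : subspace (U * V)%type) (Z : subspace V)
    k (e : 'I_k -> V) : geom_complete U -> closed [set p | G p] ->
  closed [set v | Z v] -> (forall i, Z (e i)) -> (forall v, rel_im G v -> Z v) ->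
  (forall v, Z v -> exists c : 'I_k -> R[i], rel_im G (v - \sum_i c i *: e i)) ->
  closed [set v | rel_im G v].
Proof.
move=> cU clG clZ Ze GZ ZG; apply: (closed_rel_im_finite (e := e)) => //.
move: clZ; congr closed; apply/seteqP; split=> v /=; first exact: ZG.
move=> [c /GZ Zv]; rewrite -(subrK (\sum_i c i *: e i) v).
by apply: subspaceD => //; exact: subspace_sum.
Qed.

End LinearRelations.

(** * Closed operators and their adjoints *)

Lemma subquot_finite_dim (K : nzRingType) (V : lmodType K) (A B : subspace V) :
  finite_dim (subquot A B) -> exists k (e : 'I_k -> V), (forall i, A (e i)) /\
    forall v, A v -> exists c : 'I_k -> K, B (v - \sum_i c i *: e i).
Proof.
move=> [k [x xP]]; have [e eP] := choice (fun i => subquot_class_ex (x i)).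
exists k, e; split=> [i|v Av]; first exact: subquot_class_sub (eP i).
have [y yv] := subquot_class_sur B Av; have [c yE] := xP y; exists c.
have ce : subquot_class (\sum_i c i *: x i) (\sum_i c i *: e i).
  apply: (big_ind2 (fun x v => subquot_class x v)) => [|x1 v1 x2 v2 h1 h2|i _].
  - exact: subquot_class0.
  - by rewrite -[x1]scale1r -[v1]scale1r; exact: subquot_class_linear.
  - rewrite -[_ *: x i]addr0 -[_ *: e i]addr0; apply: subquot_class_linear => //.
    exact: subquot_class0.
exact/(subquot_class_eqP yv ce).
Qed.

Lemma opZ (K : nzRingType) (U V : lmodType K) (T : linop U V) a x :
  dom T x -> T (a *: x) = a *: T x.
Proof.
move=> Tx; have := op_linear a Tx (subspace0 (dom T)).
by rewrite addr0 op0 addr0.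
Qed.

Lemma opB (K : nzRingType) (U V : lmodType K) (T : linop U V) x y :
  dom T x -> dom T y -> T (x - y) = T x - T y.
Proof.
move=> Tx Ty; rewrite -scaleN1r opD//; last exact: subspaceZ.
by rewrite opZ// scaleN1r.
Qed.

Section Operators.
Context (R : realType).
Implicit Types U V : hilbert R.

Program Definition graph (K : nzRingType) (U V : lmodType K) (T : linop U V) :
    subspace (U * V)%type :=
  @Subspace K (U * V)%type (fun p => dom T p.1 /\ p.2 = T p.1) _ _.
Next Obligation.
by move=> K U V T; split; [exact: subspace0|rewrite /= op0].
Qed.
Next Obligation.
move=> K U V T a [x v] [y w] /= [Tx ->] [Ty ->]; split; first exact: subspaceP.
by rewrite op_linear.
Qed.

Lemma closed_ker U V (T : linop U V) : closed_op T -> closed [set x | ker T x].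
Proof.
move=> clT x /closure_nrmP h.
suff [] : dom T x /\ 0 = T x by [].
apply: (clT (x, 0)); apply/closure_nrmP => e e0.
have [y [Ty y0] ye] := h e e0; exists (y, 0); first by [].
apply: le_lt_trans ye; apply: nrm_pair_le => //=.
by rewrite subrr nrm0 nrm_ge0.
Qed.

Lemma adjP U V (T : ddop U V) y : dom (adj T) y -> adj_rel T y (adj T y).
Proof. by move=> [z zP]; rewrite /= (adj_funP zP). Qed.

(** [adj_rel] records both membership in the domain of the adjoint and its value. *)
Lemma orthogonal_im_ker_adj U V (T : ddop U V) y :
  orthogonal (im T) y -> adj_rel T y 0.
Proof.
move=> oy x Tx; rewrite ip0r; apply/ip_eq0C/oy; by exists x.
Qed.

(** Riesz representation of the functional sending [T x] to [ip U x y], well defined on the range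
    because [y] is orthogonal to [ker T]. Its kernel is closed, and [w] is a multiple of a normal
    vector to it. *)
Lemma closed_range_adj U V (T : ddop U V) y : closed_op T ->
  closed [set v | im T v] -> orthogonal (ker T) y ->
  exists2 w, im T w & adj_rel T w y.
Proof.
move=> clT climT oy.
have [y0|] := pselect (forall x, dom T x -> ip U x y = 0).
  exists 0; first exact: subspace0.
  by move=> x Tx; rewrite ip0r y0.
move=> /existsNP[x0 /not_implyP[Tx0 /eqP x0y]].
(* The range of this restricted graph is the kernel of the functional; with the line of [T x0] it
   spans [im T]. *)
pose GyP (p : U * V) := graph T p /\ ip U p.1 y = 0.
have Gy0 : GyP 0 by split; [exact: subspace0|exact: ip0l].
have GyL a p p' : GyP p -> GyP p' -> GyP (a *: p + p').
  move=> [Gp py] [Gp' py']; split; first exact: subspaceP.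
  by rewrite ipDl ipZl py py' mulr0 addr0.
pose Gy := Subspace Gy0 GyL.
have imGy v : rel_im Gy v <-> exists x, [/\ dom T x, T x = v & ip U x y = 0].
  by split=> [[x [[/= Tx ->] xy]]|[x [Tx <- xy]]]; exists x.
have clN : closed [set v | rel_im Gy v].
  apply: (closed_rel_im_line (e := T x0)); first exact: complete_geom.
    move=> p /closure_nrmP h; split.
      by apply: clT; apply/closure_nrmP => e /h[p' [Gp' _] pe]; exists p'.
    apply: (@closed_orthogonal R U (eq y)) => //; apply/closure_nrmP => e /h[p' [_ py] pe].
    exists p'.1; first by move=> _ <-.
    by apply: le_lt_trans pe; exact: (nrm_fst (p - p')).
  move: climT; congr closed; apply/seteqP; split=> v.
    move=> [x Tx <-]; apply/rel_im_add.
    pose c := ip U x y / ip U x0 y; exists (c *: T x0); first by exists c.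
    apply/imGy; exists (x - c *: x0); split.
    - by apply: subspaceB => //; exact: subspaceZ.
    - by rewrite opB ?opZ//; exact: subspaceZ.
    - by rewrite ipBl ipZl divfK ?subrr.
  move=> /rel_im_add[_ [c ->] /imGy[x [Tx xv _]]]; exists (c *: x0 + x).
    exact: subspaceP.
  by rewrite op_linear// xv addrC subrK.
have [n /imGy[x' [Tx' x'n x'y]] on] := orthogonal_projection (T x0) clN.
pose x1 := x0 - x'; have Tx1 : dom T x1 by exact: subspaceB.
have x1y : ip U x1 y != 0 by rewrite ipBl x'y subr0.
have Tx1E : T x1 = T x0 - n by rewrite opB// x'n.
(* If [T x1] were 0, then [x1] would lie in [ker T] and be orthogonal to [y]. *)
have z0 : ip V (T x1) (T x1) != 0.
  apply: contra x1y => /eqP/ip_eq0 z0; apply/eqP/ip_eq0C/oy.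
  by split.
(* Scaled so that the pairing of [T x1] with [w] is [ip U x1 y]; the conjugate offsets
   conjugate-linearity in the second argument. *)
pose d := ip U x1 y / ip V (T x1) (T x1).
exists (Num.conj d *: T x1); first by apply: subspaceZ; exists x1.
move=> x Tx; rewrite ipZr conjCK.
(* [x - c *: x1] is orthogonal to [y], so its image is orthogonal to the normal [T x1]. *)
pose c := ip U x y / ip U x1 y.
have /ip_eq0C : ip V (T x1) (T x - c *: T x1) = 0.
  rewrite [in LHS]Tx1E; apply: on; apply/imGy; exists (x - c *: x1); split.
  - by apply: subspaceB => //; exact: subspaceZ.
  - by rewrite (opB Tx (subspaceZ c Tx1)) (opZ c Tx1) Tx1E.
  - by rewrite ipBl ipZl divfK ?subrr.
rewrite ipBl ipZl => /eqP; rewrite subr_eq0 => /eqP ->.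
by rewrite /c /d; field; apply/andP.
Qed.

End Operators.

(** * Relative harmonic vectors *)

Section Complexes.
Context (R : realType) (n : nat) (H : int -> hilbert R).
Implicit Types C CM Cm : hilbert_complex n H.

(** Degrees are variables tied by equations, which avoids transport between [q] and [q - 1 + 1]. *)
Lemma fredholm_fincodim C (p q r : int) : p + 1 = q -> q + 1 = r -> fredholm C ->
  exists k (e : 'I_k -> H q), (forall i, ker (C q r) (e i)) /\
    forall v, ker (C q r) v -> exists c, im (C p q) (v - \sum_i c i *: e i).
Proof.
move=> pq qr fC; subst r; have -> : p = q - 1 by rewrite -pq addrK.
exact: subquot_finite_dim (fC q).
Qed.

Lemma im_sub_ker C (p q r : int) v : p + 1 = q -> q + 1 = r ->
  im (C p q) v -> ker (C q r) v.
Proof.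
by move=> pq qr [x Cx <-]; split; [exact: hc_dom Cx|exact: hc_dd Cx].
Qed.

Lemma closed_ker_hc C (q r : int) : q + 1 = r -> closed [set v | ker (C q r) v].
Proof. by move=> qr; apply: closed_ker; exact: hc_closed. Qed.

(** By the Fredholm property the range has finite codimension in the closed kernel of the next
    differential. *)
Lemma closed_im_hc C (p q : int) : p + 1 = q -> fredholm C ->
  closed [set v | im (C p q) v].
Proof.
move=> pq fC; have [k [e [eK eP]]] := fredholm_fincodim pq erefl fC.
have E v : rel_im (graph (C p q)) v <-> im (C p q) v.
  by split=> [[x [/= Cx ->]]|[x Cx <-]]; exists x.
suff : closed [set v | rel_im (graph (C p q)) v].
  by congr closed; apply/seteqP; split=> v /E.
apply: (closed_rel_im_fincodim (Z := ker (C q (q + 1))) (e := e)) => //.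
- exact: complete_geom.
- exact: hc_closed.
- exact: closed_ker_hc.
- by move=> v /E; exact: im_sub_ker.
- by move=> v /eP[c h]; exists c; apply/E.
Qed.

Lemma laplacian_kerP CM Cm (p q r : int) x : p + 1 = q -> q + 1 = r ->
  ker (laplacian CM Cm q) x <->
  [/\ dom (adj (Cm p q)) x, dom (CM p q) (adj (Cm p q) x), dom (CM q r) x,
      dom (adj (Cm q r)) (CM q r x) &
      CM p q (adj (Cm p q) x) + adj (Cm q r) (CM q r x) = 0].
Proof.
move=> pq qr; subst r; have -> : p = q - 1 by rewrite -pq addrK.
by split=> [[[[? ?] [? ?]] ?]|[? ? ? ? ?]].
Qed.

Section Pair.
Context (CM Cm : hilbert_complex n H).
Context (fM : fredholm CM) (fm : fredholm Cm) (ext : complex_extends CM Cm).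
Context (o p q r : int) (op : o + 1 = p) (pq : p + 1 = q) (qr : q + 1 = r).

(** Since [CM] extends [Cm], a vector killed by [Cm q r] loses the second term of the Laplacian. *)
Lemma relharm_kerP s : ker (relharm_d CM Cm q r) s <->
  [/\ ker (Cm q r) s, dom (adj (Cm p q)) s & ker (CM p q) (adj (Cm p q) s)].
Proof.
split=> [[[/(laplacian_kerP _ _ _ pq qr)[as_ ds Ms Ns e] ms] s0]|[[ms s0] as_ [ds e]]].
  split=> //; split=> //; move: e.
  by rewrite (ext qr ms).2 s0 op0 addr0.
split=> //; split=> //; apply/(laplacian_kerP _ _ _ pq qr).
have [Ms Es] := ext qr ms; split=> //; rewrite Es s0 ?op0 ?e ?addr0//.
exact: subspace0.
Qed.

(** For [s = d_m t] with [t] in the kernel of the Laplacian, that equation reads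
    [delta_M s = - d_M (delta_M t)]. This makes the isomorphism well defined on classes. *)
Lemma relharm_imP s : im (relharm_d CM Cm p q) s -> im (Cm p q) s /\ im (CM o p) (adj (Cm p q) s).
Proof.
move=> [t [/(laplacian_kerP _ _ _ op pq)[a_t dt Mt Nt e] mt] <-] /=.
split; first by exists t.
have [_ Et] := ext pq mt; rewrite -Et.
exists (- adj (Cm o p) t); first by rewrite -scaleN1r; exact: subspaceZ.
rewrite -scaleN1r opZ// scaleN1r; apply/eqP.
by rewrite -subr_eq0 -opprD oppr_eq0 e.
Qed.

Lemma harm_orthogonal_im h : ker (adj (CM o p)) h -> orthogonal (im (CM o p)) h.
Proof.
move=> [ah h0] _ [u Mu <-]; apply: ip_eq0C.
by rewrite (adjP ah Mu) h0 ip0r.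
Qed.

(** [h] is orthogonal to [delta_M s] because [d_m h = 0], and to the range of [d_M] because
    [delta_m h = 0]; hence it vanishes. A preimage of [s] under [d_m] is then corrected into a
    relative harmonic one. *)
Lemma relharm_inj s h : ker (relharm_d CM Cm q r) s -> im (Cm p q) s ->
  ker (Cm p q) h -> ker (adj (CM o p)) h -> im (CM o p) (adj (Cm p q) s + h) ->
  h = 0 /\ im (relharm_d CM Cm p q) s.
Proof.
move=> /relharm_kerP[_ as_ [ds e]] [t mt ts] [mh h0] hh [u Mu Euh].
have hs : ip _ h (adj (Cm p q) s) = 0 by rewrite -(adjP as_ mh) h0 ip0l.
have hE : h = 0.
  apply: ip_eq0; have := harm_orthogonal_im hh (ex_intro2 _ _ u Mu Euh).
  by rewrite ipDr hs add0r.
split=> //; move: Euh; rewrite hE addr0 => Eu.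
(* Removing kernel components changes neither [d_m t] nor [d_M u]; it gives [delta_M (t - k) = 0]
   and makes [u - j] a value of [delta_M]. *)
have [k [mk k0] ok] := orthogonal_projection t (closed_ker_hc (C := Cm) pq).
have [j [mj j0] oj] := orthogonal_projection u (closed_ker_hc (C := Cm) op).
(* delta_M (t - k - w) = - (u - j), whose image under d_M is - d_M u, while
   d_m (t - k - w) = d_m t. *)
have [w [x mx xw] wu] := closed_range_adj (hc_closed op) (closed_im_hc op fm) oj.
have [mw w0] : ker (Cm p q) w by apply: (im_sub_ker op pq); exists x.
have [Mj Ej] := ext op mj.
have at' : adj_rel (Cm o p) (t - k) 0.
  apply: orthogonal_im_ker_adj => v /(im_sub_ker op pq); exact: ok.
have att : adj_rel (Cm o p) (t - k - w) (- (u - j)).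
  by have := adj_rel_linear (-1) wu at'; rewrite !scaleN1r addr0 [- w + _]addrC.
have mt' : dom (Cm p q) (t - k) by exact: subspaceB.
exists (t - k - w); last first.
  by rewrite /= !opB// k0 w0 !subr0.
have mtt : dom (Cm p q) (t - k - w) by exact: subspaceB.
have [Mtt Ett] := ext pq mtt.
have Es : CM p q (t - k - w) = s by rewrite Ett !opB// k0 w0 !subr0.
split=> //; apply/(laplacian_kerP _ _ _ op pq); rewrite Es.
rewrite [adj (Cm o p) _](adj_funP att).
have MN : dom (CM o p) (u - j) by exact: subspaceB.
split=> //.
- by exists (- (u - j)).
- by rewrite -scaleN1r; exact: subspaceZ.
by rewrite -scaleN1r opZ// opB// Ej j0 subr0 Eu scaleN1r addNr.
Qed.

(** Project [c] on [X] with remainder [h], and write the [A] part of the projection as [delta_M w]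
    with [w] in the range of [d_m]. Adding [w] to the part of [b] orthogonal to that range preserves
    the class of [b]. *)
Lemma relharm_surj b c : ker (Cm q r) b -> ker (CM p q) c ->
  exists s h, [/\ ker (relharm_d CM Cm q r) s,
    ker (Cm p q) h /\ ker (adj (CM o p)) h,
    im (Cm p q) (b - s) & im (CM o p) (c - (adj (Cm p q) s + h))].
Proof.
move=> Kb Kc.
have clim := closed_im_hc pq fm.
have [b2 Ib2 ob1] := orthogonal_projection b clim.
pose A := subspaceI (ker (CM p q)) (orthogonal (ker (Cm p q))).
(* A sum of closed subspaces need not be closed; this one is the range of a closed relation and has
   finite codimension in [ker (CM p q)], as it contains the range of [CM o p]. *)
pose X := rel_im (rel_add (graph (CM o p)) A).
have clA : closed [set v | A v].
  move=> v clv; split.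
    by apply: (closed_ker_hc (C := CM) pq) => B /clv[w [[? ?] ?]]; exists w.
  by apply: closed_orthogonal => B /clv[w [[? ?] ?]]; exists w.
have XP v : X v <-> exists2 a, A a & im (CM o p) (v - a).
  split=> [/rel_im_add[a Aa [u [/= Mu uE]]]|[a Aa [u Mu uE]]].
    by exists a => //; exists u.
  by apply/rel_im_add; exists a => //; exists u.
have clX : closed [set v | X v].
  have [k [e [eK eP]]] := fredholm_fincodim op pq fM.
  apply: (closed_rel_im_fincodim (Z := ker (CM p q)) (e := e)) => //.
  - by apply: prod_geom; exact: complete_geom.
  - by apply: closed_rel_add => //; exact: hc_closed.
  - exact: closed_ker_hc.
  - move=> v /XP[a [Ka _] /(im_sub_ker op pq) Kva].
    by rewrite -(subrK a v); exact: subspaceD.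
  - move=> v /eP[f Iv]; exists f; apply/XP; exists 0; first exact: subspace0.
    by rewrite subr0.
have [x Xx oh] := orthogonal_projection c clX.
have imX v : im (CM o p) v -> X v.
  by move=> Iv; apply/XP; exists 0; [exact: subspace0|rewrite subr0].
have AX v : A v -> X v.
  by move=> Av; apply/XP; exists v; rewrite ?subrr//; exact: subspace0.
have /XP[a [Ka oa] Ixa] := Xx.
have [w Iw wa] := closed_range_adj (hc_closed pq) clim oa.
set h := c - x in oh.
have Kx : ker (CM p q) x.
  by rewrite -(subrK a x); apply: subspaceD => //; exact: im_sub_ker Ixa.
have Kh : ker (CM p q) h by exact: subspaceB.
(* [h] minus its projection [k] on [ker (Cm p q)] lies in [A], so it is orthogonal to both [h] and
   [k]. *)
have Kmh : ker (Cm p q) h.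
  have [k Kk ok] := orthogonal_projection h (closed_ker_hc (C := Cm) pq).
  suff -> : h = k by [].
  apply/eqP; rewrite -subr_eq0; apply/eqP/ip_eq0.
  rewrite [LHS]ipBl (ip_eq0C (ok _ Kk)) subr0; apply/oh/AX; split=> //.
  apply: subspaceB => //; split; first exact: (ext pq Kk.1).1.
  by rewrite (ext pq Kk.1).2 Kk.2.
have ah : adj_rel (CM o p) h 0.
  by apply: orthogonal_im_ker_adj => v /imX; exact: oh.
pose s := b - b2 + w.
have asa : adj_rel (Cm p q) s a.
  have := adj_rel_linear 1 wa (orthogonal_im_ker_adj ob1).
  by rewrite !scale1r addr0 addrC.
have sE : adj (Cm p q) s = a := adj_funP asa.
exists s, h; split.
- apply/relharm_kerP; rewrite sE; split=> //; last by exists a.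
  apply: subspaceD; last exact: im_sub_ker Iw.
  by apply: subspaceB => //; exact: im_sub_ker Ib2.
- by split=> //; split; [exists 0|exact: adj_funP].
- by rewrite /s opprD addrA subKr; exact: subspaceB.
- by rewrite sE /h opprD addrCA subKr addrC.
Qed.

End Pair.
End Complexes.

Theorem theorem1p0p2 (R : realType) (n : nat) (H : int -> hilbert R)
    (CM Cm : hilbert_complex n H) (hCM : fredholm CM) (hCm : fredholm Cm)
    (hext : complex_extends CM Cm) (q : int) :
  lmod_iso (relharm_cohomology CM Cm q * harm_m CM Cm (q - 1))%type
           (cohomology Cm q * cohomology CM (q - 1))%type.
Proof.
have pq : q - 1 + 1 = q by rewrite subrK.
have op : q - 1 - 1 + 1 = q - 1 by rewrite subrK.
(* [cohomology] and [harm_m] in degree [q - 1] use the differential into degree [q - 1 + 1]. *)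
have ker_idx (C : hilbert_complex n H) v :
    ker (C (q - 1) (q - 1 + 1)) v <-> ker (C (q - 1) q) v by rewrite pq.
pose delta := adj (Cm (q - 1) q).
have harmP (h : harm_m CM Cm (q - 1)) :
    ker (Cm (q - 1) q) (val h) /\ ker (adj (CM (q - 1 - 1) (q - 1))) (val h).
  by case: h => h /= /asboolP[/ker_idx].
have harm_sur h : ker (Cm (q - 1) q) h -> ker (adj (CM (q - 1 - 1) (q - 1))) h ->
    exists h' : harm_m CM Cm (q - 1), val h' = h.
  move=> /ker_idx h1 h2.
  have hP : h \in subspace_pred (subspaceI (ker (Cm (q - 1) (q - 1 + 1)))
      (ker (delta_m CM (q - 1) (q - 1 - 1)))) by apply/asboolP.
  by exists (SubspaceType hP).
(* The classes in degree [q] share the representative [s]; independence of its choice is the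
   functionality clause at 0. *)
pose phi (v : relharm_cohomology CM Cm q * harm_m CM Cm (q - 1))
    (w : cohomology Cm q * cohomology CM (q - 1)) :=
  exists s, [/\ subquot_class v.1 s, subquot_class w.1 s &
    subquot_class w.2 (delta s + val v.2)].
apply: (@lmod_iso_rel _ _ _ phi).
- move=> a v v' w w' [s [vs ws dw]] [s' [vs' ws' dw']]; exists (a *: s + s').
  have [_ ds _] := (relharm_kerP hext pq erefl s).1 (subquot_class_sub vs).
  have [_ ds' _] := (relharm_kerP hext pq erefl s').1 (subquot_class_sub vs').
  split; [exact: subquot_class_linear|exact: subquot_class_linear|].
  have -> : delta (a *: s + s') + val (a *: v + v').2 =
      a *: (delta s + val v.2) + (delta s' + val v'.2).
    by rewrite /delta op_linear// scalerDr addrACA.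
  exact: subquot_class_linear.
- move=> [x h]; have [s xs] := subquot_class_ex x.
  have [ms ds Ms] := (relharm_kerP hext pq erefl s).1 (subquot_class_sub xs).
  have [y ys] := subquot_class_sur (im (Cm (q - 1) q)) ms.
  have [mh _] := harmP h.
  have Mh : ker (CM (q - 1) q) (delta s + val h).
    apply: subspaceD => //; split; first exact: (hext _ _ pq _ mh.1).1.
    by rewrite (hext _ _ pq _ mh.1).2 mh.2.
  have [z zs] := subquot_class_sur (im (CM (q - 1 - 1) (q - 1))) ((ker_idx _ _).2 Mh).
  by exists (y, z); exists s.
- move=> [y z]; have [b yb] := subquot_class_ex y; have [c zc] := subquot_class_ex z.
  have Kb := subquot_class_sub yb; have /ker_idx Kc := subquot_class_sub zc.
  have [s [h [Ks [mh ah] Ib Ic]]] := relharm_surj hCM hCm hext op pq erefl Kb Kc.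
  have [h' hE] := harm_sur h mh ah.
  have [x xs] := subquot_class_sur (im (relharm_d CM Cm (q - 1) q)) Ks.
  exists (x, h'); exists s; split=> //=.
  + apply: (subquot_class_shift yb) => //.
    by have [] := (relharm_kerP hext pq erefl s).1 Ks.
  + apply: (subquot_class_shift zc); rewrite /= hE//; apply/ker_idx.
    rewrite -(subKr c (_ + _)); apply: subspaceB => //.
    exact: im_sub_ker Ic.
(* Well-definedness: here [s] represents 0 and the harmonic component is 0. *)
- move=> [y z] [s [/= vs ys zs]].
  have [Is IM] := relharm_imP hext op pq ((subquot_class0P vs).1 erefl).
  congr (_, _); first exact/(subquot_class0P ys).
  apply/(subquot_class0P zs).
  have IM0 : im (CM (q - 1 - 1) (q - 1)) (delta s + 0) by rewrite addr0.
  exact: IM0.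
(* Injectivity: both target classes vanish, which is the situation of [relharm_inj]. *)
move=> [x h] [s [/= xs ys zs]]; have [mh ah] := harmP h.
have Is := (subquot_class0P ys).1 erefl; have Ic := (subquot_class0P zs).1 erefl.
have [h0 Ids] := relharm_inj hCm hext op pq erefl (subquot_class_sub xs) Is mh ah Ic.
by congr (_, _); [exact/(subquot_class0P xs)|exact: val_inj].
Qed.
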